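(* Let $\beta,\gamma$ be positive real parameters such that $\beta\ge\gamma$ and $\beta\gamma>1$, and let $\lambda^{\star}:=\left(\frac{\beta}{\gamma}\right)^{d^{\star}/2}$ where $d^{\star}:=\frac{\pi}{\arctan\sqrt{\beta\gamma-1}}$. For every $\lambda'<\lambda^{\star}$ there exists $\delta>0$ such that for every finite graph $G=(V,E)$ with $\deg_G(v)\ge 2$ for all $v\in V$, writing $n=|V|$, we have $Z_{\mathrm{spin}}(G;\beta,\gamma,\vec z)\neq 0$ for all $\vec z=(z_v)_{v\in V}\in\mathbb{C}^n$ with $|\operatorname{Im} z_v|\le\delta$ and $-\delta\le\operatorname{Re} z_v\le\lambda'+\delta$ for every $v\in V$.
   Context: For a finite graph $G=(V,E)$ and $\sigma:V\to\{0,1\}$, let $m_0(\sigma)$ (resp. $m_1(\sigma)$) be the number of edges with both endpoints assigned $0$ (resp. $1$). The multivariate partition function with vertex-dependent external fields $\vec\lambda=(\lambda_v)_{v\in V}\in\mathbb{C}^V$ is $Z_{\mathrm{spin}}(G;\beta,\gamma,\vec\lambda)=\sum_{\sigma:V\to\{0,1\}}\beta^{m_0(\sigma)}\gamma^{m_1(\sigma)}\prod_{v\in V}\lambda_v^{[\sigma(v)=1]}$, where $[\cdot]$ is the indicator. The arctangent is the principal branch with values in $(-\pi/2,\pi/2)$. *)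

(* Defs.v *)
From HB Require Import structures.
From mathcomp Require Import all_boot all_order all_algebra.
From mathcomp Require Import complex.
From mathcomp Require Import reals exp trigo.

Set Implicit Arguments.
Unset Strict Implicit.
Unset Printing Implicit Defensive.

Import Order.TTheory GRing.Theory Num.Theory.
Local Open Scope ring_scope.
Local Open Scope complex_scope.

(* Edges are unordered pairs of distinct vertices: graphs are simple. *)
Record sgraph (V : finType) := SGraph {
  edges : {set {set V}};
  card_edge : forall e : {set V}, e \in edges -> #|e| = 2%N
}.

Definition deg (V : finType) (G : sgraph V) (v : V) : nat :=
  #|[set e in edges G | v \in e]|.

(* The spins 0 and 1 are encoded as false and true. *)
Definition mono_edges (V : finType) (G : sgraph V) (i : bool)
    (sigma : {ffun V -> bool}) : nat :=
  #|[set e in edges G | [forall v in e, sigma v == i]]|.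

Definition Zspin (R : realType) (V : finType) (G : sgraph V)
    (beta gamma : R) (lambda : V -> R[i]) : R[i] :=
  \sum_(sigma : {ffun V -> bool})
    beta%:C ^+ mono_edges G false sigma * gamma%:C ^+ mono_edges G true sigma
    * \prod_(v : V) lambda v ^+ (sigma v == true).

Definition dstar (R : realType) (beta gamma : R) : R :=
  pi / atan (Num.sqrt (beta * gamma - 1)).

Definition lambdastar (R : realType) (beta gamma : R) : R :=
  (beta / gamma) `^ (dstar beta gamma / 2).

(* Main.v *)
Require Import Defs.
From HB Require Import structures.
From mathcomp Require Import all_boot all_order all_algebra.
From mathcomp Require Import complex.
From mathcomp Require Import reals exp trigo.
From mathcomp Require Import classical_sets topology normedtype sequences derive.
From mathcomp Require Import ring lra.

Set Implicit Arguments.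
Unset Strict Implicit.
Unset Printing Implicit Defensive.

Import Order.TTheory GRing.Theory Num.Theory.
Import ComplexField.Normc.
Import numFieldNormedType.Exports.
Local Open Scope ring_scope.
Local Open Scope complex_scope.

(* Let [k = ln (beta / gamma) / (2 theta)] with
   [theta = atan (sqrt (beta gamma - 1)) = pi / dstar], and consider the logarithmic
   spiral region [|z| < exp (k |arg (- z)|)]. Its complement [K] contains [- x y]
   for all [x], [y] in [K] because [|arg|] is subadditive, so Asano contraction
   maps polynomials without zeros in the region to polynomials without zeros in
   the same region. Since [exp (k pi) = lambdastar], the region contains a
   neighbourhood of the segment from [0] to [lambda'].

   It remains to see that [beta + x + y + gamma x y] has no zero in the region.
   On its zero set, [y] is the image of [x] under an elliptic involution, which
   after rescaling reads [1 + X Y = cos theta (X + Y)] and is the hyperbolic half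
   turn of the upper half plane about [exp (i theta)]. With [log X] and [log Y]
   written as [A + i M] plus or minus [B + i N], this becomes
   [cosh A cos M = cos theta cosh B cos N] and
   [sinh A sin M = cos theta sinh B sin N]. As [|A| <= |B|], the angle [M] is at
   most the hypotenuse of the right spherical triangle with legs [theta] and [N].
   The hypotenuse is a convex function of the leg [N], hence
   [(M - theta) sin M <= cos theta N sin N]; with the convexity of [sinh],
   [B (M - theta) <= A N] follows, which keeps one of [X], [Y] out of the rescaled
   region. *)

(** * Convexity and spherical trigonometry over the reals *)

Section RealInequalities.
Variable R : realType.
Implicit Types (x y a b c k th M N A B : R).

(** The mean value theorem on [[0, a]] and on [[a, b]] compares the slopes of the two chords. This
    is the growth of [f x / x] for convex [f] with [f 0 = 0], free of division. *)
Lemma chord_slope_homo (f df : R -> R) a b :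
    (forall x, is_derive x 1 f (df x)) -> f 0 = 0 ->
    (forall x y, 0 <= x -> x <= y -> y <= b -> df x <= df y) ->
  0 <= a -> a <= b -> b * f a <= a * f b.
Proof.
move=> f_df f0 df_homo a_ge0 le_ab.
have cf c d : {within `[c, d], continuous f}%classic.
  apply: continuous_subspaceT => x; apply: differentiable_continuous.
  by apply/derivable1_diffP; case: (f_df x).
have [xi1 xi1P e1] := @MVT_segment _ f df 0 a a_ge0 (fun x _ => f_df x) (cf _ _).
have [xi2 xi2P e2] := @MVT_segment _ f df a b le_ab (fun x _ => f_df x) (cf _ _).
move: xi1P xi2P; rewrite !in_itv /= => /andP[? ?] /andP[? ?].
have := df_homo xi1 xi2; move: e1 e2; rewrite f0 !subr0 => e1 e2 h.
have {}h : df xi1 <= df xi2 by apply: h => //; lra.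
have -> : f b = df xi1 * a + df xi2 * (b - a) by lra.
rewrite e1; have : 0 <= (df xi2 - df xi1) * (a * (b - a)).
  by rewrite !mulr_ge0 ?subr_ge0.
nra.
Qed.

Lemma le_cos x y : 0 <= x -> x <= y -> y <= pi -> cos y <= cos x.
Proof.
move=> x0; rewrite le_eqVlt => /predU1P[->//|xy] yb.
by apply: ltW; rewrite ltr_cos // in_itv /=; apply/andP; split; lra.
Qed.

Lemma le_sin x y : - (pi / 2) <= x -> x <= y -> y <= pi / 2 -> sin x <= sin y.
Proof.
move=> x0; rewrite le_eqVlt => /predU1P[->//|xy] yb.
by apply: ltW; rewrite ltr_sin // in_itv /=; apply/andP; split; lra.
Qed.

Lemma sin_chord a b : 0 <= a -> a <= b -> b <= pi -> a * sin b <= b * sin a.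
Proof.
move=> a0 ab bpi.
have h x : is_derive x 1 (fun t => - sin t) (- cos x) by apply: is_deriveN.
have := chord_slope_homo h; rewrite sin0 oppr0 => /(_ a b erefl).
rewrite !mulrN lerN2; apply=> // x y x0 xy yb.
by rewrite lerN2 le_cos // (le_trans yb).
Qed.

Lemma sinh_chord a b : 0 <= a -> a <= b ->
  b * (expR a - expR (- a)) <= a * (expR b - expR (- b)).
Proof.
move=> a0 ab.
have h x : is_derive x 1 (fun t : R => expR t - expR (- t)) (expR x + expR (- x)).
  have hN : is_derive x 1 (expR \o -%R) (- expR (- x)).
    by apply: is_derive_eq; rewrite /GRing.scale /= mulrN1 ?mulN1r.
  by apply: is_derive_eq; rewrite opprK.
have := chord_slope_homo h; rewrite oppr0 subrr => /(_ a b erefl).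
apply=> // x y x0 xy yb.
have ex : expR x * expR (- x) = 1 by rewrite -expRD subrr expR0.
have ey : expR y * expR (- y) = 1 by rewrite -expRD subrr expR0.
have := expR_gt0 (- x); have := expR_gt0 (-y).
have : expR x <= expR y by rewrite ler_expR.
have : 1 <= expR x by rewrite -expR0 ler_expR.
move: (expR x) (expR y) (expR (- x)) (expR (- y)) ex ey.
move=> ux uy vx vy ex ey h1 h2 h3 h4.
have vx1 : vx <= 1 by nra.
have vy1 : vy <= 1 by nra.
(* Since [ux * vx = uy * vy = 1], this product equals [(uy + vy) - (ux + vx)]. *)
have : 0 <= (uy - ux) * (1 - vx * vy).
  by rewrite mulr_ge0 ?subr_ge0 // mulr_ile1 // ltW.
have -> : (uy - ux) * (1 - vx * vy) = uy - ux - vx * (uy * vy) + vy * (ux * vx) by ring.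
by rewrite ex ey; lra.
Qed.

(** The hypothesis amounts to [cos th - cos M <= cos th * (1 - cos N)]; each side is twice a product
    of half-angle sines. *)
Lemma sin_half_prod_le th M N : cos th * cos N <= cos M ->
  sin ((M - th) / 2) * sin ((M + th) / 2) <= cos th * sin (N / 2) ^+ 2.
Proof.
have eM : M = (M + th) / 2 + (M - th) / 2 by field.
have eth : th = (M + th) / 2 - (M - th) / 2 by field.
have eN : N = N / 2 + N / 2 by field.
rewrite {1}eN cosD {1}eM cosD.
have := cos2Dsin2 (N / 2).
have : cos th = cos ((M + th) / 2) * cos ((M - th) / 2) +
                sin ((M + th) / 2) * sin ((M - th) / 2) by rewrite {1}eth cosB.
set c := cos th; move: (cos (N / 2)) (sin (N / 2)) (cos ((M + th) / 2))
  (sin ((M + th) / 2)) (cos ((M - th) / 2)) (sin ((M - th) / 2)).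
move=> cn sn cp sp cm sm ec en h.
have e : cn * cn = 1 - sn ^+ 2 by rewrite -en; ring.
by rewrite e in h; lra.
Qed.

(** As [sin ((M - th) / 2) <= sin ((M + th) / 2)] and [cos th <= 1], the half-angle inequality gives
    [sin ((M - th) / 2) <= sin (N / 2)]. *)
Lemma triangle_le th M N : 0 <= th -> th <= M -> M <= pi / 2 -> 0 <= N -> N <= pi / 2 ->
  cos th * cos N <= cos M -> M - th <= N.
Proof.
move=> th0 thM Mpi N0 Npi /sin_half_prod_le h.
have pi0 := pi_gt0 R.
have c1 := cos_le1 th.
have sm : 0 <= sin ((M - th) / 2) by apply: sin_ge0_pi; apply/andP; split; lra.
have sn : 0 <= sin (N / 2) by apply: sin_ge0_pi; apply/andP; split; lra.
have sp : sin ((M - th) / 2) <= sin ((M + th) / 2) by apply: le_sin; lra.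
have : sin ((M - th) / 2) <= sin (N / 2) by rewrite -ler_sqr ?nnegrE //; nra.
rewrite leNgt => /negP h2; rewrite leNgt; apply/negP => h3; apply: h2.
by rewrite ltr_sin ?in_itv /=; try (apply/andP; split); lra.
Qed.

(** The hypotenuse [h(N)] has derivative [cos th * sin N / sin h], so this is the tangent inequality
    [h(N) - h(0) <= N * h'(N)]. Half angles replace derivatives in the proof. *)
Lemma hypotenuse_convex th M N : 0 < th -> th <= M -> M <= pi / 2 ->
    0 <= N -> N <= pi / 2 ->
  cos th * cos N <= cos M -> (M - th) * sin M <= cos th * (N * sin N).
Proof.
move=> th0 thM Mpi N0 Npi h.
have pi0 := pi_gt0 R.
have c0 : 0 <= cos th by apply: cos_ge0_pihalf; apply/andP; split; lra.
have cN0 : 0 <= cos N by apply: cos_ge0_pihalf; apply/andP; split; lra.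
have c1 := cos_le1 th; have cN1 := cos_le1 N.
(* [(M - th) * sin M] grows with [M] on [[th, pi / 2]], so [M] may be raised to the hypotenuse. *)
wlog eM : M thM Mpi h / cos M = cos th * cos N.
  set x := cos th * cos N => hw.
  have x01 : 0 <= x <= 1 by apply/andP; split; rewrite /x; nra.
  have x11 : -1 <= x <= 1 by lra.
  have ex : cos (acos x) = x by rewrite acosK // in_itv.
  have := acos_ge0 x11; have := acos_lepi x11 => ax1 ax0.
  have leM : M <= acos x.
    rewrite leNgt; apply/negP => lt1.
    suff : cos M < cos (acos x) by rewrite ex ltNge h.
    by rewrite ltr_cos // in_itv /=; apply/andP; split; lra.
  have le2 : acos x <= pi / 2.
    rewrite leNgt; apply/negP => lt1.
    suff : cos (acos x) < cos (pi / 2) by rewrite ex cos_pihalf ltNge; case/andP: x01 => ->.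
    by rewrite ltr_cos // in_itv /=; apply/andP; split; lra.
  have le3 : th <= acos x by lra.
  apply: le_trans (hw (acos x) le3 le2 _ ex); last by rewrite ex.
  apply: ler_pM; rewrite ?lerD2r //; first by lra.
    by apply: sin_ge0_pi; lra.
  by apply: le_sin; lra.
have := triangle_le (ltW th0) thM Mpi N0 Npi h.
have := sin_half_prod_le h.
set m := (M - th) / 2; set n := N / 2; set p := (M + th) / 2 => h1 h2.
have mn : m <= n by rewrite /m /n; lra.
have m0 : 0 <= m by rewrite /m; lra.
have n0 : 0 <= n by lra.
have nsm : m * sin n <= n * sin m by apply: sin_chord => //; rewrite /n; lra.
have sM : sin M = 2 * (sin (M / 2) * cos (M / 2)).
  have {1}-> : M = M / 2 + M / 2 by field.
  by rewrite sinD; ring.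
have sN : sin N = 2 * (sin n * cos n).
  have {1}-> : N = n + n by rewrite /n; field.
  by rewrite sinD; ring.
have MN : N <= M.
  rewrite leNgt; apply/negP => lt1.
  have lt2 : cos N < cos M by rewrite ltr_cos // in_itv /=; apply/andP; split; lra.
  by nra.
have cMn : cos (M / 2) <= cos n by apply: le_cos; rewrite /n; lra.
have sMp : sin (M / 2) <= sin p by apply: le_sin; rewrite /p; lra.
have sm0 : 0 <= sin m by apply: sin_ge0_pi; rewrite /m; lra.
have sn0 : 0 <= sin n by apply: sin_ge0_pi; rewrite /n; lra.
have sM0 : 0 <= sin (M / 2) by apply: sin_ge0_pi; lra.
have cM0 : 0 <= cos (M / 2) by apply: cos_ge0_pihalf; lra.
have cn0 : 0 <= cos n by apply: le_trans cM0 _.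
rewrite sM sN; have -> : M - th = 2 * m by rewrite /m; field.
have -> : N = 2 * n by rewrite /n; field.
suff h3 : m * (sin (M / 2) * cos (M / 2)) <= cos th * (n * (sin n * cos n)) by lra.
have [n_eq0|n_neq0] := eqVneq n 0.
  by rewrite (_ : m = 0) ?n_eq0 ?sin0 ?mul0r ?mulr0 //; lra.
have sn_gt0 : 0 < sin n.
  by apply: sin_gt0_pi; rewrite lt_neqAle eq_sym n_neq0 n0 /= /n; lra.
rewrite -(ler_pM2r sn_gt0).
(* Combines [nsm], [sMp] and [cMn]; then [h1] bounds [sin m * sin p] by [cos th * sin n ^+ 2]. *)
apply: (@le_trans _ _ (n * sin m * (sin p * cos n))).
  rewrite mulrAC; apply: ler_pM => //; first exact: mulr_ge0.
  - exact: mulr_ge0.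
  - exact: ler_pM.
have := ler_wpM2l (mulr_ge0 n0 cn0) h1; lra.
Qed.
End RealInequalities.

(** * The half turn in logarithmic coordinates *)

Section HyperbolicRotation.
Variable R : realType.
Implicit Types (x y a b c k th M N A B : R).

(** Twice the hyperbolic cosine; [S] is twice the hyperbolic sine. *)
Let C x := expR x + expR (- x).
Let S x := expR x - expR (- x).

Let CS x : C x ^+ 2 = 4 + S x ^+ 2.
Proof. by rewrite /C /S; have := expRxMexpNx_1 x; nra. Qed.

Let SN x : S (- x) = - S x.
Proof. by rewrite /S opprK opprB. Qed.

Let CN x : C (- x) = C x.
Proof. by rewrite /C opprK addrC. Qed.

Let C_gt0 x : 0 < C x.
Proof. by rewrite addr_gt0 ?expR_gt0. Qed.

Let S_lt x y : x < y -> S x < S y.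
Proof. by move=> xy; rewrite ltrD ?ltrN2 ?ltr_expR // ltrN2. Qed.

Let S_gt0 x : 0 < x -> 0 < S x.
Proof. by move/S_lt; rewrite {1}/S oppr0 subrr. Qed.

Let S_sqr_norm x : S `|x| ^+ 2 = S x ^+ 2.
Proof. by case: (ger0P x) => _ //; rewrite SN sqrrN. Qed.

Let S_sqr_lt x y : `|x| < `|y| -> S x ^+ 2 < S y ^+ 2.
Proof.
move=> xy; rewrite -(S_sqr_norm x) -(S_sqr_norm y).
have h0 : 0 <= S `|x|.
  by have := normr_ge0 x; rewrite le_eqVlt => /predU1P[<-|/S_gt0/ltW//]; rewrite /S oppr0 subrr.
by rewrite ltr_sqr ?nnegrE ?S_lt //; apply: le_trans h0 (ltW (S_lt xy)).
Qed.

Let S_sqr_le x y : `|x| <= `|y| -> S x ^+ 2 <= S y ^+ 2.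
Proof.
rewrite le_eqVlt => /predU1P[exy|/S_sqr_lt/ltW//].
by rewrite -(S_sqr_norm x) exy S_sqr_norm.
Qed.

(** If [|B| < |A|], the ratios [C B / C A] and [S B / S A] are below 1 in absolute value, and
    squaring and adding the equations gives [1 <= cos th ^+ 2]. *)
Let half_turn_norm_le th A B M N : 0 < cos th < 1 ->
    C A * cos M = cos th * (C B * cos N) ->
    S A * sin M = cos th * (S B * sin N) ->
  `|A| <= `|B|.
Proof.
move=> /andP[c0 c1] eC eS; rewrite leNgt; apply/negP => /S_sqr_lt SBA.
have eC2 : C A ^+ 2 * cos M ^+ 2 = cos th ^+ 2 * (C B ^+ 2 * cos N ^+ 2).
  by rewrite -!exprMn eC.
have eS2 : S A ^+ 2 * sin M ^+ 2 = cos th ^+ 2 * (S B ^+ 2 * sin N ^+ 2).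
  by rewrite -!exprMn eS.
rewrite !CS in eC2.
have SB0 := sqr_ge0 (S B).
have : cos M ^+ 2 <= cos th ^+ 2 * cos N ^+ 2.
  rewrite -(@ler_pM2l _ (4 + S A ^+ 2)); last by lra.
  rewrite eC2 [leRHS]mulrCA ler_wpM2l ?sqr_ge0 // ler_wpM2r ?sqr_ge0 //; lra.
have : sin M ^+ 2 <= cos th ^+ 2 * sin N ^+ 2.
  rewrite -(@ler_pM2l _ (S A ^+ 2)); last by lra.
  rewrite eS2 [leRHS]mulrCA ler_wpM2l ?sqr_ge0 // ler_wpM2r ?sqr_ge0 //; lra.
have := cos2Dsin2 M; have := cos2Dsin2 N; nra.
Qed.

(** The absolute value encodes a disjunction: [k * (M + N - th) <= A + B] or
    [k * (M - N - th) <= A - B], one case for each of the two points. *)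
Lemma half_turn_separation k th A B M N :
    0 < th < pi / 2 -> 0 <= k -> 0 <= M <= pi -> - (pi / 2) <= N <= pi / 2 ->
    (expR A + expR (- A)) * cos M = cos th * ((expR B + expR (- B)) * cos N) ->
    (expR A - expR (- A)) * sin M = cos th * ((expR B - expR (- B)) * sin N) ->
  k * (M - th) <= A + `|B - k * N|.
Proof.
rewrite -/(C A) -/(C B) -/(S A) -/(S B).
(* Exchanging the two points negates both [B] and [N]. *)
wlog B0 : B N / 0 <= B.
  move=> hw; have [B0|B0] := leP 0 B; first exact: hw.
  move=> hth hk hM hN eC eS.
  have -> : `|B - k * N| = `|- B - k * - N|.
    by rewrite -normrN; congr `|_|; ring.
  apply: (hw (- B) (- N)); rewrite // ?CN ?cosN ?SN ?sinN ?mulrNN //; first by lra.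
  by move: hN; lra.
move=> /andP[th0 thpi] k0 /andP[M0 Mpi] /andP[N1 N2] eC eS.
have pi0 := pi_gt0 R.
have c0 : 0 < cos th by apply: cos_gt0_pihalf; lra.
have c1 : cos th < 1 by rewrite -[X in _ < X](cos0 R) ltr_cos // in_itv /=; lra.
have cN0 : 0 <= cos N by apply: cos_ge0_pihalf; lra.
have nAB : `|A| <= `|B| by apply: (half_turn_norm_le _ eC eS); rewrite c0.
move: (nAB); rewrite (ger0_norm B0) ler_norml => /andP[BA AB].
have CAB : C A <= C B.
  by rewrite -ler_sqr ?nnegrE ?(ltW (C_gt0 _)) // !CS lerD2l S_sqr_le.
have cMN : cos th * cos N <= cos M.
  rewrite -(ler_pM2l (C_gt0 A)) eC mulrCA.
  by rewrite ler_wpM2l ?(ltW c0) // ler_wpM2r.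
have Mpi2 : M <= pi / 2.
  rewrite leNgt; apply/negP => lt1.
  have : cos M < cos (pi / 2) by rewrite ltr_cos // in_itv /=; lra.
  by rewrite cos_pihalf; nra.
have MthN : M - th <= `|N|.
  have [Mth|Mth] := leP M th; first by rewrite (le_trans _ (normr_ge0 _)) // subr_le0.
  by apply: triangle_le; rewrite ?cos_norm ?normr_ge0 // ?ler_norml; lra.
(* For [N <= 0] the bounds [- B <= A] and [M - th <= - N] suffice. *)
have [N0|N0] := leP N 0.
  rewrite ler0_norm // in MthN.
  rewrite ger0_norm ?subr_ge0; last by nra.
  by nra.
rewrite gtr0_norm // in MthN.
have sN0 : 0 < sin N by apply: sin_gt0_pi; lra.
have A0 : 0 <= A.
  rewrite leNgt; apply/negP => A0.
  have B1 : 0 < B by lra.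
  have SB0 := S_gt0 B1.
  have SA0 : S A < 0 by rewrite -oppr_gt0 -SN S_gt0 // oppr_gt0.
  have sM0 : 0 <= sin M by apply: sin_ge0_pi; lra.
  have : 0 < cos th * (S B * sin N) by rewrite !mulr_gt0.
  by rewrite -eS; nra.
have norm0 := normr_ge0 (B - k * N).
have [Mth|Mth] := leP M th; first by nra.
(* After multiplication by [sin M * S B]: convexity of the hypotenuse, then [eS] to trade
   [cos th * (S B * sin N)] for [S A * sin M], then convexity of sinh. *)
have BMth : B * (M - th) <= A * N.
  move: B0; rewrite le_eqVlt => /predU1P[eB|B1]; first by rewrite -eB mul0r mulr_ge0 // ltW.
  have SB0 := S_gt0 B1.
  have sM0 : 0 < sin M by apply: sin_gt0_pi; lra.
  have h1 : (M - th) * sin M <= cos th * (N * sin N).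
    by apply: hypotenuse_convex => //; lra.
  have h2 : B * S A <= A * S B by apply: sinh_chord.
  rewrite -(ler_pM2r (mulr_gt0 sM0 SB0)).
  apply: (@le_trans _ _ (B * S B * (cos th * (N * sin N)))).
    have := ler_wpM2l (ltW (mulr_gt0 B1 SB0)) h1; lra.
  have -> : B * S B * (cos th * (N * sin N)) = N * sin M * (B * S A).
    rewrite [RHS](_ : _ = N * B * (S A * sin M)); last by ring.
    by rewrite eS; ring.
  have := ler_wpM2l (ltW (mulr_gt0 N0 sM0)) h2; lra.
(* Multiplied by [N], the goal is the sum of [BMth] and a bound on [(M - th) * (k * N - B)]. *)
rewrite -(ler_pM2r N0).
have h3 : k * N - B <= `|B - k * N| by rewrite -normrN opprB ler_norm.
have : (M - th) * (k * N - B) <= N * `|B - k * N|.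
  apply: (@le_trans _ _ ((M - th) * `|B - k * N|)).
    by rewrite ler_wpM2l // subr_ge0 ltW.
  by rewrite ler_wpM2r.
by lra.
Qed.

End HyperbolicRotation.

(** * Subadditivity of the absolute argument *)

Section AbsArgument.
Variable R : realType.
Local Notation Re := complex.Re.
Local Notation Im := complex.Im.
Implicit Types (z w : R[i]) (r : R).

Lemma normc_Re_Im z : normc z ^+ 2 = Re z ^+ 2 + Im z ^+ 2.
Proof. by case: z => a b; rewrite /= sqr_sqrtr // addr_ge0 ?sqr_ge0. Qed.

Lemma normc_ge0 z : 0 <= normc z.
Proof. by case: z => a b; exact: sqrtr_ge0. Qed.

Lemma normc_gt0 z : z != 0 -> 0 < normc z.
Proof.
move=> z0; rewrite lt_neqAle normc_ge0 andbT eq_sym.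
by apply: contra z0 => /eqP/eq0_normc ->.
Qed.

Lemma normc_real r : 0 <= r -> normc r%:C = r.
Proof. by move=> r0; rewrite /= expr0n addr0 sqrtr_sqr ger0_norm. Qed.

(* The absolute value of the principal argument; it is [pi / 2] at [0]. *)
Definition carg z : R := acos (Re z / normc z).

Lemma carg_bound z : -1 <= Re z / normc z <= 1.
Proof.
have [->|/normc_gt0 z0] := eqVneq z 0; first by rewrite mul0r; lra.
have := normc_Re_Im z; have := sqr_ge0 (Im z) => h1 h2.
rewrite ler_pdivlMr // ler_pdivrMr //; apply/andP; split; nra.
Qed.

Lemma carg_ge0 z : 0 <= carg z. Proof. exact/acos_ge0/carg_bound. Qed.

Lemma carg_lepi z : carg z <= pi. Proof. exact/acos_lepi/carg_bound. Qed.

Lemma Re_polar z : Re z = normc z * cos (carg z).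
Proof.
have [->|/normc_gt0 z0] := eqVneq z 0; first by rewrite normc0 mul0r.
by rewrite acosK ?in_itv ?carg_bound //= mulrC divfK // gt_eqF.
Qed.

Lemma Im_polar z : `|Im z| = normc z * sin (carg z).
Proof.
have s0 : 0 <= sin (carg z) by apply: sin_ge0_pi; rewrite carg_ge0 carg_lepi.
apply/eqP; rewrite -(@eqrXn2 _ 2) ?mulr_ge0 ?normc_ge0 ?normr_ge0 //.
rewrite real_normK ?num_real // exprMn sin2cos2 mulrBr mulr1 -exprMn -Re_polar.
by rewrite normc_Re_Im addrC addKr.
Qed.

(** [|z| |w| cos (carg z + carg w)] equals [Re z Re w - |Im z| |Im w|], which is at most
    [Re (z * w)], and cos decreases on [[0, pi]]. A sum beyond [pi] is harmless because
    [carg (z * w) <= pi]. *)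
Lemma cargM_le z w : z != 0 -> w != 0 -> carg (z * w) <= carg z + carg w.
Proof.
move=> /normc_gt0 z0 /normc_gt0 w0; rewrite leNgt; apply/negP => lt1.
have := carg_lepi (z * w); have := carg_ge0 z; have := carg_ge0 w => h1 h2 h3.
have : cos (carg (z * w)) < cos (carg z + carg w).
  by rewrite ltr_cos // in_itv /=; lra.
rewrite cosD -(ltr_pM2l (mulr_gt0 z0 w0)) -normcM -Re_polar normcM.
have -> : normc z * normc w *
    (cos (carg z) * cos (carg w) - sin (carg z) * sin (carg w)) =
    (normc z * cos (carg z)) * (normc w * cos (carg w)) -
    (normc z * sin (carg z)) * (normc w * sin (carg w)) by ring.
rewrite -!Re_polar -!Im_polar -normrM.
have -> : Re (z * w) = Re z * Re w - Im z * Im w by case: z {z0 lt1 h2 h3} w {w0 h1} => [? ?] [? ?].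
by rewrite ltrD2l ltrN2 ltNge ler_norm.
Qed.

Lemma cargZ r z : 0 < r -> carg (r%:C * z) = carg z.
Proof.
move=> r0; rewrite /carg normcM normc_real ?ltW //.
have -> : Re (r%:C * z) = r * Re z by case: z => a b /=; rewrite mul0r subr0.
by rewrite -mulf_div divff ?mul1r // gt_eqF.
Qed.

Lemma carg_real r : 0 < r -> carg r%:C = 0.
Proof.
by move=> r0; rewrite /carg normc_real ?ltW //= divff ?gt_eqF // acos1.
Qed.

End AbsArgument.

(** * The half turn on complex numbers *)

Section HalfTurn.
Variable R : realType.
Local Notation Re := complex.Re.
Local Notation Im := complex.Im.
Implicit Types (x y z w X Y : R[i]) (c k th r : R).

(** From [Y = (c X - 1) / (X - c)] one gets [Im Y = (1 - c^2) Im X / |X - c|^2]; the case [X = c]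
    would force [c^2 = 1]. *)
Lemma half_turn_Im X Y c : 0 < c < 1 -> 1 + X * Y = c%:C * (X + Y) ->
  (0 <= Im X -> 0 <= Im Y) /\ (Im X <= 0 -> Im Y <= 0).
Proof.
move: X Y => [x1 x2] [y1 y2] /andP[c0 c1] /eqP.
rewrite eq_complex /= => /andP[/eqP e1 /eqP e2].
have {}e1 : 1 + (x1 * y1 - x2 * y2) = c * (x1 + y1) - 0 * (x2 + y2) :> R := e1.
have d0 : 0 < (x1 - c) ^+ 2 + x2 ^+ 2.
  rewrite lt_neqAle addr_ge0 ?sqr_ge0 // andbT eq_sym paddr_eq0 ?sqr_ge0 //.
  rewrite !sqrf_eq0 subr_eq0; apply/negP => /andP[/eqP ex1 /eqP ex2].
  have c2 : c * c < 1 by rewrite mulr_ilt1 // ltW.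
  by rewrite ex1 ex2 in e1; lra.
have e : ((x1 - c) ^+ 2 + x2 ^+ 2) * y2 = (1 - c ^+ 2) * x2.
  apply/eqP; rewrite -subr_eq0; apply/eqP.
  transitivity ((x1 - c) * (0 + (x1 * y2 + x2 * y1) - (c * (x2 + y2) + 0 * (x1 + y1)))
    - x2 * (1 + (x1 * y1 - x2 * y2) - (c * (x1 + y1) - 0 * (x2 + y2)))); first by ring.
  by rewrite e1 e2 !subrr !mulr0 subrr.
have c2 : 0 < 1 - c ^+ 2 by nra.
split=> hx; first by rewrite -(pmulr_rge0 _ d0) e mulr_ge0 // ltW.
by rewrite -(pmulr_rle0 _ d0) e mulr_ge0_le0 // ltW.
Qed.

(* Both equations come from rotating [1 + XY = c (X + Y)] by [-M], where [M] is
   half the argument of [XY]. *)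
Lemma half_angle_rotation (F : fieldType) (a a' b b' CM SM CN SN c : F) :
    a * a' = 1 -> b * b' = 1 -> CM ^+ 2 + SM ^+ 2 = 1 ->
    1 + (a * b * (CM * CN - SM * SN) * (a * b' * (CM * CN + SM * SN)) -
      a * b * (SM * CN + CM * SN) * (a * b' * (SM * CN - CM * SN))) =
      c * (a * b * (CM * CN - SM * SN) + a * b' * (CM * CN + SM * SN)) ->
    a * b * (CM * CN - SM * SN) * (a * b' * (SM * CN - CM * SN)) +
      a * b * (SM * CN + CM * SN) * (a * b' * (CM * CN + SM * SN)) =
      c * (a * b * (SM * CN + CM * SN) + a * b' * (SM * CN - CM * SN)) ->
    CN ^+ 2 + SN ^+ 2 = 1 ->
  (a + a') * CM = c * ((b + b') * CN) /\ (a - a') * SM = c * ((b - b') * SN).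
Proof.
move=> aV bV Q e1 e2 QN.
have a0 : a != 0 by apply: contra_eq_neq aV => ->; rewrite mul0r eq_sym oner_eq0.
have {}e1 : 1 + a ^+ 2 * (CM ^+ 2 - SM ^+ 2) =
    c * (a * b * (CM * CN - SM * SN) + a * b' * (CM * CN + SM * SN)).
  rewrite -e1; congr (1 + _).
  transitivity (a ^+ 2 * (b * b') * ((CM ^+ 2 - SM ^+ 2) * (CN ^+ 2 + SN ^+ 2))); last by ring.
  by rewrite bV QN !mulr1.
have {}e2 : a ^+ 2 * (CM * SM + SM * CM) =
    c * (a * b * (SM * CN + CM * SN) + a * b' * (SM * CN - CM * SN)).
  rewrite -e2.
  transitivity (a ^+ 2 * (b * b') * ((CM * SM + SM * CM) * (CN ^+ 2 + SN ^+ 2))); last by ring.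
  by rewrite bV QN !mulr1.
split; apply: (mulfI a0).
- transitivity (CM * (1 + a ^+ 2 * (CM ^+ 2 - SM ^+ 2)) + SM * (a ^+ 2 * (CM * SM + SM * CM))).
    transitivity (a ^+ 2 * CM * (CM ^+ 2 + SM ^+ 2) + CM); last by ring.
    by rewrite Q mulrA mulrDr aV; ring.
  rewrite e1 e2; transitivity (c * a * (b + b') * CN * (CM ^+ 2 + SM ^+ 2)); first by ring.
  by rewrite Q; ring.
- transitivity (CM * (a ^+ 2 * (CM * SM + SM * CM)) - SM * (1 + a ^+ 2 * (CM ^+ 2 - SM ^+ 2))).
    transitivity (a ^+ 2 * SM * (CM ^+ 2 + SM ^+ 2) - SM); last by ring.
    by rewrite Q mulrA mulrBr aV; ring.
  rewrite e1 e2; transitivity (c * a * (b - b') * SN * (CM ^+ 2 + SM ^+ 2)); first by ring.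
  by rewrite Q; ring.
Qed.

(** Each alternative places one of the points outside the rescaled spiral region, so the two are
    never both inside. *)
Lemma half_turn_log k th X Y : 0 < th < pi / 2 -> 0 <= k -> X != 0 -> Y != 0 ->
    1 + X * Y = (cos th)%:C * (X + Y) ->
  k * (carg X - th) <= ln (normc X) \/ k * (carg Y - th) <= ln (normc Y).
Proof.
move=> hth k0 X0 Y0 eXY.
have /andP[th0 thpi] := hth; have pi0 := pi_gt0 R.
have c0 : 0 < cos th by apply: cos_gt0_pihalf; lra.
have c1 : cos th < 1 by rewrite -[X in _ < X](cos0 R) ltr_cos // in_itv /=; lra.
have [im1 im2] : (0 <= Im X -> 0 <= Im Y) /\ (Im X <= 0 -> Im Y <= 0).
  by apply: half_turn_Im eXY; rewrite c0.
(* [X] and [Y] lie on the same side of the real axis; conjugating both if necessary makes [carg] a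
   genuine argument. *)
have [e1 e2] : 1 + (Re X * Re Y - `|Im X| * `|Im Y|) = cos th * (Re X + Re Y) /\
    Re X * `|Im Y| + `|Im X| * Re Y = cos th * (`|Im X| + `|Im Y|).
  move: X Y eXY im1 im2 {X0 Y0} => [x1 x2] [y1 y2] /eqP.
  rewrite eq_complex /= => /andP[/eqP h1 /eqP h2] im1 im2.
  have [/[dup] hx /im1 hy|/ltW/[dup] hx /im2 hy] := leP 0 x2.
    by rewrite !ger0_norm //; split; nra.
  by rewrite !ler0_norm //; split; nra.
move: e1 e2; rewrite !Re_polar !Im_polar.
have := carg_lepi X; have := carg_ge0 X; have := carg_lepi Y; have := carg_ge0 Y.
pose A := (ln (normc X) + ln (normc Y)) / 2; pose B := (ln (normc X) - ln (normc Y)) / 2.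
have eX : normc X = expR A * expR B.
  by rewrite -expRD -[LHS]lnK ?posrE ?normc_gt0 //; congr expR; rewrite /A /B; field.
have eY : normc Y = expR A * expR (- B).
  by rewrite -expRD -[LHS]lnK ?posrE ?normc_gt0 //; congr expR; rewrite /A /B; field.
have -> : ln (normc X) = A + B by rewrite /A /B; field.
have -> : ln (normc Y) = A - B by rewrite /A /B; field.
rewrite eX eY.
pose M := (carg X + carg Y) / 2; pose N := (carg X - carg Y) / 2.
have -> : carg X = M + N by rewrite /M /N; field.
have -> : carg Y = M - N by rewrite /M /N; field.
move=> h1 h2 h3 h4 e1 e2.
have hM : 0 <= M <= pi by lra.
have hN : - (pi / 2) <= N <= pi / 2 by lra.
have Q : cos M ^+ 2 + sin M ^+ 2 = 1 := cos2Dsin2 M.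
have aV := expRxMexpNx_1 A.
move: e1 e2; rewrite !cosD !sinD cosN sinN.
rewrite !mulrN !opprK => e1 e2.
have [E1 E2] := half_angle_rotation (expRxMexpNx_1 A) (expRxMexpNx_1 B) Q e1 e2 (cos2Dsin2 N).
have := half_turn_separation hth k0 hM hN E1 E2.
(* The sign of [B - k * N] tells which point is outside. *)
by case: ger0P => _ h; [left|right]; lra.
Qed.
End HalfTurn.

(** * The spiral region, Asano contraction and the edge polynomial *)

Section SpiralRegion.
Variable R : realType.
Implicit Types (a b c d t w x y z : R[i]) (k th r : R).

Definition spiral_region k z : bool := normc z < expR (k * carg (- z)).

Lemma spiral_region0 k : spiral_region k 0.
Proof. by rewrite /spiral_region normc0 expR_gt0. Qed.

Lemma spiral_region_lt1 k z : 0 <= k -> normc z < 1 -> spiral_region k z.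
Proof.
move=> k0 z1; apply: lt_le_trans z1 _.
by rewrite -expR0 ler_expR mulr_ge0 ?carg_ge0.
Qed.

Lemma spiral_regionNreal k r : 0 < r -> spiral_region k (- r%:C) = (r < 1).
Proof.
by move=> r0; rewrite /spiral_region opprK carg_real // mulr0 expR0 normcN normc_real // ltW.
Qed.

Lemma spiral_exterior_mulN k x y : 0 <= k ->
  ~~ spiral_region k x -> ~~ spiral_region k y -> ~~ spiral_region k (- (x * y)).
Proof.
move=> k0 Sx Sy.
have x0 : x != 0 by apply: contraNneq Sx => ->; exact: spiral_region0.
have y0 : y != 0 by apply: contraNneq Sy => ->; exact: spiral_region0.
move: Sx Sy; rewrite /spiral_region -!leNgt opprK normcN normcM => Sx Sy.
apply: (@le_trans _ _ (expR (k * carg (- x)) * expR (k * carg (- y)))).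
  rewrite -expRD ler_expR -mulrDr ler_wpM2l //.
  by rewrite -[x * y]mulrNN cargM_le ?oppr_eq0.
by apply: ler_pM; rewrite ?expR_ge0.
Qed.

(** Take [x = - r] with [q < r < 1]: the region contains [- r], and [t / r] keeps the argument of
    [t] while [r > q] bounds its modulus. Two values of [r] are given so that a vanishing
    denominator can be avoided. *)
Lemma spiral_region_split k t : 0 <= k -> t != 0 -> spiral_region k t ->
  exists x1 x2, x1 != x2 /\
    forall x, x \in [:: x1; x2] -> [/\ x != 0, spiral_region k x & spiral_region k (- t / x)].
Proof.
move=> k0 t0 St.
pose q := normc t / expR (k * carg (- t)).
have q0 : 0 < q by rewrite divr_gt0 ?expR_gt0 ?normc_gt0.
have q1 : q < 1 by rewrite ltr_pdivrMr ?expR_gt0 // mul1r.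
have key r : q < r < 1 -> [/\ - r%:C != 0, spiral_region k (- r%:C)
    & spiral_region k (- t / - r%:C)].
  move=> /andP[qr r1]; have r0 : 0 < r := lt_trans q0 qr.
  rewrite spiral_regionNreal // oppr_eq0 -[0]/(0%:C) (inj_eq (@complexI _)) gt_eqF //.
  split=> //; rewrite invrN mulrNN mulrC -[_^-1](fmorphV (real_complex R)).
  rewrite /spiral_region -mulrN cargZ ?invr_gt0 // normcM normc_real ?invr_ge0 ?(ltW r0) //.
  by rewrite mulrC ltr_pdivrMr // mulrC -ltr_pdivrMr ?expR_gt0.
exists (- ((1 + q) / 2)%:C), (- ((2 + q) / 3)%:C); split.
  by rewrite eqr_opp (inj_eq (@complexI _)); apply/eqP; lra.
by move=> x; rewrite !inE => /orP[]/eqP ->; apply: key; lra.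
Qed.

(* If [a + d t = 0] with [t] in the region, then substituting [y = - t / x] turns
   the polynomial into [g(w, x) / x] with [g] symmetric in [w] and [x]. The root
   [w] of [g(_, x)] yields a zero in the region, at [(w, - t / x)] or at
   [(x, - t / w)]. *)
Lemma asano_contraction k a b c d : 0 <= k ->
    (forall w y, spiral_region k w -> spiral_region k y ->
       a + b * w + c * y + d * (w * y) != 0) ->
  forall t, spiral_region k t -> a + d * t != 0.
Proof.
move=> k0 f0 t St; apply/eqP => adt.
have a0 : a != 0.
  by have := f0 0 0 (spiral_region0 k) (spiral_region0 k); rewrite !mulr0 !addr0.
have t0 : t != 0 by apply: contra_neq a0 => t0; rewrite -adt t0 mulr0 addr0.
have d0 : d != 0 by apply: contra_neq a0 => d0; rewrite -adt d0 mul0r addr0.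
have [x1 [x2 [x12 split_t]]] := spiral_region_split k0 t0 St.
(* [b * x1 = b * x2 = d * t] with [d * t != 0] would force [x1 = x2]. *)
have [x xP bx] : exists2 x, x \in [:: x1; x2] & b * x - d * t != 0.
  have [b1|b1] := eqVneq (b * x1 - d * t) 0; last by exists x1; rewrite ?mem_head.
  exists x2; first by rewrite !inE eqxx orbT.
  apply: contra_neq x12 => b2.
  have b0 : b != 0.
    apply: contra_neq (mulf_neq0 d0 t0) => b0.
    by move/eqP: b1; rewrite b0 mul0r sub0r oppr_eq0 => /eqP.
  by apply: (mulfI b0); apply: (addIr (- (d * t))); rewrite b1 b2.
have [x0 Sx Stx] := split_t x xP.
pose g w x := b * (w * x) - d * t * (w + x) - c * t.
have gE w y : y != 0 -> a + b * w + c * (- t / y) + d * (w * (- t / y)) = g w y / y.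
  move=> y0; have -> : a = - (d * t) by apply/eqP; rewrite -addr_eq0 adt.
  by rewrite /g; field.
pose w := t * (d * x + c) / (b * x - d * t).
have gw : g w x = 0 by rewrite /g /w; field.
have [Sw|Sw] := boolP (spiral_region k w).
  by have := f0 w _ Sw Stx; rewrite gE // gw mul0r eqxx.
have w0 : w != 0 by apply: contraNneq Sw => ->; exact: spiral_region0.
(* Otherwise [w] and [- t / w] are both exterior, hence so is [- (w * (- t / w)) = t]. *)
have Stw : spiral_region k (- t / w).
  apply: contraLR St => Stw; have := spiral_exterior_mulN k0 Sw Stw.
  by rewrite mulrC divfK // opprK.
have := f0 x _ Sx Stw; rewrite gE // (_ : g x w = g w x) ?gw ?mul0r ?eqxx //.
by rewrite /g [x * w]mulrC [x + w]addrC.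
Qed.

(** With [X = - s x], [Y = - s y] and [s = expR (- (k * th))], a zero satisfies
    [1 + X Y = cos th (X + Y)]. Zero values of [x] or [y] are treated apart because logarithms are
    taken. *)
Lemma spiral_edge_neq0 k th x y : 0 <= k -> 0 < th < pi / 2 ->
    spiral_region k x -> spiral_region k y ->
  (expR (k * th) / cos th)%:C + x + y + (expR (- (k * th)) / cos th)%:C * (x * y) != 0.
Proof.
move=> k0 hth.
have /andP[th0 thpi] := hth; have pi0 := pi_gt0 R.
have c0 : 0 < cos th by apply: cos_gt0_pihalf; lra.
have c1 : cos th < 1 by rewrite -[X in _ < X](cos0 R) ltr_cos // in_itv /=; lra.
wlog x0 : x y / x != 0.
  move=> hw; have [->|x0] := eqVneq x 0; last exact: hw.
  have [->|y0] := eqVneq y 0.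
    by rewrite !mulr0 !addr0 -[0]/(0%:C) (inj_eq (@complexI _)) mulf_neq0 ?invr_eq0 ?gt_eqF ?expR_gt0.
  by move=> Sx Sy; have := hw y 0 y0 Sy Sx; rewrite mul0r !mulr0 !addr0.
move=> Sx Sy; apply/eqP => e.
(* For [y = 0] the root [x] is a real number below -1, outside the region. *)
have [y0|y0] := eqVneq y 0.
  move: e Sx; rewrite y0 !mulr0 !addr0 addrC => /eqP; rewrite addr_eq0 => /eqP ->.
  rewrite spiral_regionNreal ?divr_gt0 ?expR_gt0 // ltr_pdivrMr // mul1r.
  have : 1 <= expR (k * th) by rewrite -expR0 ler_expR mulr_ge0 // ltW.
  by lra.
pose s := expR (- (k * th)); have s0 : 0 < s by apply: expR_gt0.
have sV : expR (k * th) = s^-1 by rewrite /s expRN invrK.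
have nlog z : z != 0 -> k * (carg (s%:C * - z) - th) <= ln (normc (s%:C * - z)) ->
    ~~ spiral_region k z.
  move=> z0; rewrite cargZ // normcM normcN normc_real ?(ltW s0) // lnM ?posrE ?normc_gt0 //.
  rewrite expRK mulrBr [leRHS]addrC lerD2r -ler_expR lnK ?posrE ?normc_gt0 //.
  by rewrite /spiral_region -leNgt.
have sX z : z != 0 -> s%:C * - z != 0.
  by move=> z0; rewrite mulf_neq0 ?oppr_eq0 // -[0]/(0%:C) (inj_eq (@complexI _)) gt_eqF.
suff eXY : 1 + (s%:C * - x) * (s%:C * - y) = (cos th)%:C * (s%:C * - x + s%:C * - y).
  have [/(nlog _ x0)|/(nlog _ y0)] := half_turn_log hth k0 (sX x x0) (sX y y0) eXY.
    by rewrite Sx.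
  by rewrite Sy.
have S0 : s%:C != 0 by rewrite -[0]/(0%:C) (inj_eq (@complexI _)) gt_eqF.
have C0 : (cos th)%:C != 0 by rewrite -[0]/(0%:C) (inj_eq (@complexI _)) gt_eqF.
apply/eqP; rewrite -subr_eq0; apply/eqP.
transitivity ((cos th)%:C * s%:C *
  (s%:C^-1 / (cos th)%:C + x + y + s%:C / (cos th)%:C * (x * y))).
  by field; rewrite S0 C0.
by move: e; rewrite sV -/s !rmorphM !fmorphV /= => ->; rewrite mulr0.
Qed.

End SpiralRegion.

(** * Partition functions built edge by edge *)

Section EdgeList.
Variables (F : fieldType) (V : finType) (beta gamma : F).
Implicit Types (s : seq {set V}) (z : V -> F) (sigma : {ffun V -> bool}).

Definition edge_weight (e : {set V}) sigma : F :=
  beta ^+ [forall v in e, sigma v == false] * gamma ^+ [forall v in e, sigma v == true].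

Definition Zedges s z : F :=
  \sum_(sigma : {ffun V -> bool})
    (\prod_(e <- s) edge_weight e sigma) * \prod_(v : V) z v ^+ (sigma v == true).

Lemma Zedges_nil z : Zedges [::] z = \prod_v (1 + z v).
Proof.
transitivity (\prod_v \sum_(b : bool) z v ^+ (b == true)).
  by rewrite bigA_distr_bigA; apply: eq_bigr => sigma _; rewrite big_nil mul1r.
by apply: eq_bigr => v _; rewrite big_bool /= addrC.
Qed.

Lemma edge_weight2 u v sigma :
  edge_weight [set u; v] sigma =
    beta ^+ (~~ sigma u && ~~ sigma v) * gamma ^+ (sigma u && sigma v).
Proof.
have all2 b : [forall x in [set u; v], sigma x == b] = (sigma u == b) && (sigma v == b).
  apply/forall_inP/andP => [h|[h1 h2] x].
    by split; apply: h; rewrite !inE eqxx ?orbT.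
  by rewrite !inE => /orP[]/eqP ->.
by rewrite /edge_weight !all2 !eqb_id !eqbF_neg.
Qed.

Let two_sites u v z a b : V -> F :=
  fun x => if x == u then a else if x == v then b else z x.

(** The coefficient of [a ^+ i * b ^+ j] in [Zedges], as a polynomial in the fields [a] at [u] and
    [b] at [v]. *)
Let coef s u v z i j : F :=
  \sum_(sigma : {ffun V -> bool} | (sigma u == i) && (sigma v == j))
    (\prod_(e <- s) edge_weight e sigma) *
    \prod_(x | (x != u) && (x != v)) z x ^+ (sigma x == true).

(** [g] stays general: the constant 1 gives [Zedges s], the weight of the edge [uv] gives the list
    with that edge added. *)
Let split_two_sites s u v z a b (g : bool -> bool -> F) : u != v ->
  \sum_(sigma : {ffun V -> bool}) g (sigma u) (sigma v) *
    ((\prod_(e <- s) edge_weight e sigma) *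
     \prod_x two_sites u v z a b x ^+ (sigma x == true)) =
  g false false * coef s u v z false false + g false true * b * coef s u v z false true
  + g true false * a * coef s u v z true false
  + g true true * (a * b) * coef s u v z true true.
Proof.
move=> uv.
have prodE sigma : \prod_x two_sites u v z a b x ^+ (sigma x == true) =
    a ^+ (sigma u) * (b ^+ (sigma v) *
      \prod_(x | (x != u) && (x != v)) z x ^+ (sigma x == true)).
  rewrite (bigD1 u) //= (bigD1 v) 1?eq_sym //= {1 2}/two_sites !eqxx.
  rewrite [v == u]eq_sym (negbTE uv) !eqb_id; congr (_ * (_ * _)).
  by apply: eq_bigr => x /andP[xu xv]; rewrite /two_sites (negbTE xu) (negbTE xv).
rewrite (partition_big (fun sigma => (sigma u, sigma v)) predT) //=.
rewrite -(pair_bigA _ (fun i j => \sum_(sigma : {ffun V -> bool} | (sigma u, sigma v) == (i, j))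
    g (sigma u) (sigma v) * ((\prod_(e <- s) edge_weight e sigma) *
     \prod_x two_sites u v z a b x ^+ (sigma x == true)))) /=.
have inner i j : \sum_(sigma : {ffun V -> bool} | (sigma u, sigma v) == (i, j))
    g (sigma u) (sigma v) * ((\prod_(e <- s) edge_weight e sigma) *
     \prod_x two_sites u v z a b x ^+ (sigma x == true)) =
    g i j * (a ^+ i * b ^+ j) * coef s u v z i j.
  rewrite /coef mulr_sumr; apply: eq_big => // sigma; rewrite xpair_eqE => /andP[/eqP eu /eqP ev].
  by rewrite prodE eu ev; ring.
by rewrite !big_bool !inner /=; ring.
Qed.

(** Adding an edge means multiplying by the edge polynomial in two fresh variables, then contracting
    once at [u] and once at [v]. *)
Lemma Zedges_cons_neq0 (S : pred F) s u v z :
    (forall a b c d, (forall w y, S w -> S y -> a + b * w + c * y + d * (w * y) != 0) ->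
      forall t, S t -> a + d * t != 0) ->
    (forall x y, S x -> S y -> beta + x + y + gamma * (x * y) != 0) ->
    (forall z, (forall v, S (z v)) -> Zedges s z != 0) ->
    u != v -> (forall v, S (z v)) -> Zedges ([set u; v] :: s) z != 0.
Proof.
move=> contraction edge_neq0 Zs uv Sz.
set A := coef s u v z.
have A_neq0 a b : S a -> S b ->
    A false false + b * A false true + a * A true false + a * b * A true true != 0.
  move=> Sa Sb.
  have := split_two_sites s z a b (fun _ _ => 1) uv.
  rewrite !mul1r => <-; under eq_bigr do rewrite mul1r.
  apply: Zs => x; rewrite /two_sites.
  by case: ifP => // _; case: ifP.
have -> : Zedges ([set u; v] :: s) z =
    beta * A false false + z v * A false true + z u * A true false
    + gamma * (z u * z v) * A true true.
  have := split_two_sites s z (z u) (z v)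
    (fun i j => beta ^+ (~~ i && ~~ j) * gamma ^+ (i && j)) uv.
  rewrite /= !mulr1 !mul1r => <-; apply: eq_bigr => sigma _.
  rewrite big_cons edge_weight2 -!mulrA; do 3!congr (_ * _).
  apply: eq_bigr => x _; congr (_ ^+ _); rewrite /two_sites.
  by case: eqP => [->//|_]; case: eqP => [->|].
(* Contraction at [u]: [x1] from [Zedges s] and [x2] from the edge merge into [a]. *)
have step1 a w y : S a -> S w -> S y ->
    (A false false + A false true * w) * (beta + y) +
    (A true false + A true true * w) * (1 + gamma * y) * a != 0.
  move=> Sa Sw Sy.
  apply: (contraction _ ((A true false + A true true * w) * (beta + y))
    ((A false false + A false true * w) * (1 + gamma * y))) Sa => x1 x2 S1 S2.
  have := mulf_neq0 (A_neq0 x1 w S1 Sw) (edge_neq0 x2 y S2 Sy).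
  by congr (_ != 0); ring.
have -> : beta * A false false + z v * A false true + z u * A true false
    + gamma * (z u * z v) * A true true =
    (A false false * beta + z u * A true false) +
    (A false true + z u * gamma * A true true) * z v by ring.
(* Contraction at [v]: [w] and [y] merge into [z v]. *)
apply: (contraction _ (A false true * beta + z u * A true true)
  (A false false + z u * gamma * A true false)) (Sz v) => w y Sw Sy.
by have := step1 (z u) w y (Sz u) Sw Sy; congr (_ != 0); ring.
Qed.

Lemma Zedges_neq0 (S : pred F) s z :
    (forall x, S x -> 1 + x != 0) ->
    (forall a b c d, (forall w y, S w -> S y -> a + b * w + c * y + d * (w * y) != 0) ->
      forall t, S t -> a + d * t != 0) ->
    (forall x y, S x -> S y -> beta + x + y + gamma * (x * y) != 0) ->
    {in s, forall e : {set V}, #|e| = 2%N} -> (forall v, S (z v)) -> Zedges s z != 0.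
Proof.
move=> vertex_neq0 contraction edge_neq0.
elim: s z => [|e s IHs] z card2 Sz.
  by rewrite Zedges_nil; apply/prodf_neq0 => v _; exact: vertex_neq0.
have /eqP/cards2P[u [v [uv ->]]] := card2 e (mem_head _ _).
apply: Zedges_cons_neq0 uv Sz => // z' Sz'; apply: IHs => // e' e's.
by apply: card2; rewrite inE e's orbT.
Qed.

End EdgeList.

(** * Passage to graphs and choice of parameters *)

Lemma Zspin_Zedges (R : realType) (V : finType) (G : sgraph V) (beta gamma : R)
    (z : V -> R[i]) :
  Zspin G beta gamma z = Zedges beta%:C gamma%:C (enum (edges G)) z.
Proof.
apply: eq_bigr => sigma _; congr (_ * _).
rewrite big_split /= !prodrXr.
have monoE i : (\sum_(e <- enum (edges G)) [forall v in e, sigma v == i])%N =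
    mono_edges G i sigma.
  rewrite /mono_edges -sum1_card big_enum /= -big_mkcondr /=.
  by apply: eq_bigl => e; rewrite inE.
by rewrite !monoE.
Qed.

(** The open unit disc lies in the region. Elsewhere a point of the strip has [carg (- z) >= pi - e]
    and modulus below [L = expR (k * (pi - e))]. *)
Lemma strip_subset_spiral_region (R : realType) (k l : R) : 0 <= k -> l < expR (k * pi) ->
  exists delta, 0 < delta /\ forall z : R[i],
    `|complex.Im z| <= delta -> - delta <= complex.Re z <= l + delta -> spiral_region k z.
Proof.
move=> k0 lE; have pi2 := pi_ge2 R; set E := expR (k * pi) in lE.
have E0 : 0 < E by apply: expR_gt0.
have kE0 : 0 <= k * E by rewrite mulr_ge0 // ltW.
have [e [e0 epi le]] : exists e, [/\ 0 < e, e < pi & l < expR (k * (pi - e))].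
  (* By [expR (- (k * e)) >= 1 - k * e], this [e] costs at most half of the gap [E - l]. *)
  exists (Num.min 1 ((E - l) / (2 * (k * E + 1)))); set e := Num.min _ _.
  have e0 : 0 < e by rewrite lt_min ltr01 divr_gt0 ?subr_gt0 // mulr_gt0 //; lra.
  have e1 : e <= 1 by rewrite ge_min lexx.
  have : e <= (E - l) / (2 * (k * E + 1)) by rewrite ge_min lexx orbT.
  rewrite ler_pdivlMr; last by lra.
  move=> e2; split=> //; first by lra.
  have -> : k * (pi - e) = k * pi + - (k * e) by ring.
  rewrite expRD -/E; apply: lt_le_trans (_ : E * (1 + - (k * e)) <= _).
    by have : 0 <= e * (k * E) by [rewrite mulr_ge0 // ltW]; lra.
  by rewrite ler_wpM2l ?expR_ge1Dx // ltW.
set L := expR (k * (pi - e)) in le.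
have cose : 0 < 1 - cos e by rewrite subr_gt0 -[X in _ < X](cos0 R) ltr_cos // in_itv /=; lra.
(* When [|z| >= 1], these bounds yield in turn [Re z >= 0], [Re z >= |z| cos e] and
   [|z| <= l + 2 delta < L]. *)
pose delta := Num.min (1 / 3) (Num.min (1 - cos e) ((L - l) / 3)).
have d1 : delta <= 1 / 3 by rewrite ge_min lexx.
have d2 : delta <= 1 - cos e by rewrite /delta !ge_min lexx !orbT.
have d3 : delta <= (L - l) / 3 by rewrite /delta !ge_min lexx !orbT.
exists delta; split; first by rewrite !lt_min cose; lra.
move=> z zIm zRe; have [z1|z1] := ltP (normc z) 1; first exact: spiral_region_lt1.
have zle : normc z <= `|complex.Re z| + `|complex.Im z|.
  rewrite -ler_sqr ?nnegrE ?addr_ge0 ?normc_ge0 // normc_Re_Im sqrrD !real_normK ?num_real //.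
  by rewrite lerD2r lerDl mulrn_wge0 // mulr_ge0.
have Re0 : 0 <= complex.Re z.
  rewrite leNgt; apply/negP => Re0.
  by rewrite (ltr0_norm Re0) in zle; lra.
rewrite (ger0_norm Re0) in zle.
apply: (@lt_le_trans _ _ L); first by lra.
rewrite ler_expR ler_wpM2l // leNgt; apply/negP => lt1.
have := carg_ge0 (- z) => c0.
have : cos (pi - e) < cos (carg (- z)) by rewrite ltr_cos // in_itv /=; lra.
rewrite cosB cospi sinpi mul0r addr0 mulN1r -(ltr_pM2l (lt_le_trans ltr01 z1)).
rewrite -[normc z in X in _ < X]normcN -Re_polar.
have -> : complex.Re (- z) = - complex.Re z by case: (z).
have := ler_pM2r cose 1 (normc z); rewrite z1 mul1r => h.
by lra.
Qed.

Theorem theorem20 (R : realType) (beta gamma : R)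
    (beta_gt0 : 0 < beta) (gamma_gt0 : 0 < gamma)
    (gamma_le_beta : gamma <= beta) (betagamma_gt1 : 1 < beta * gamma)
    (lambda' : R) (lambda'_lt : lambda' < lambdastar beta gamma) :
  exists delta : R, 0 < delta /\
    forall (V : finType) (G : sgraph V),
      (forall v : V, (2 <= deg G v)%N) ->
      forall z : V -> R[i],
        (forall v : V,
          `|complex.Im (z v)| <= delta /\
          - delta <= complex.Re (z v) <= lambda' + delta) ->
        Zspin G beta gamma z != 0.
Proof.
pose th := atan (Num.sqrt (beta * gamma - 1)).
have th0 : 0 < th by rewrite /th -(atan0 R) lt_atan // sqrtr_gt0 subr_gt0.
have hth : 0 < th < pi / 2 by rewrite th0 atan_ltpi2.
(* Then [expR (k * th)] is the square root of [beta / gamma]; as [cos th] is the inverse root of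
   [beta * gamma], dividing [expR (k * th)] and its inverse by [cos th] gives [beta] and [gamma]. *)
pose k := ln (beta / gamma) / (2 * th).
have bg0 : 0 < beta / gamma by rewrite divr_gt0.
have k0 : 0 <= k.
  by rewrite divr_ge0 ?ln_ge0 ?ler_pdivlMr ?mul1r // mulr_ge0 // ltW.
have Ek : expR (k * th) = Num.sqrt (beta / gamma).
  apply/eqP; rewrite -(@eqrXn2 _ 2) ?expR_ge0 ?sqrtr_ge0 // sqr_sqrtr ?(ltW bg0) //.
  rewrite -expRM_natl (_ : 2 * (k * th) = ln (beta / gamma)) ?lnK //.
  by rewrite /k; field; rewrite gt_eqF.
have cth : cos th = (Num.sqrt (beta * gamma))^-1.
  by rewrite cos_atan sqr_sqrtr ?subr_ge0 ?(ltW betagamma_gt1) // addrC subrK.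
have betaE : expR (k * th) / cos th = beta.
  rewrite Ek cth invrK -sqrtrM ?(ltW bg0) //.
  rewrite (_ : beta / gamma * (beta * gamma) = beta ^+ 2) ?sqrtr_sqr ?gtr0_norm //.
  by field; rewrite gt_eqF.
have gammaE : expR (- (k * th)) / cos th = gamma.
  rewrite expRN Ek cth invrK -sqrtrV ?(ltW bg0) // -sqrtrM ?invr_ge0 ?(ltW bg0) //.
  rewrite (_ : (beta / gamma)^-1 * (beta * gamma) = gamma ^+ 2) ?sqrtr_sqr ?gtr0_norm //.
  by field; rewrite !gt_eqF.
have lE : lambda' < expR (k * pi).
  move: lambda'_lt; rewrite /lambdastar /powR gt_eqF //.
  rewrite (_ : dstar beta gamma / 2 * ln (beta / gamma) = k * pi) //.
  by rewrite /dstar -/th /k; field; rewrite gt_eqF.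
have [delta [delta0 strip]] := strip_subset_spiral_region k0 lE.
exists delta; split=> // V G _ z zP; rewrite Zspin_Zedges.
apply: (Zedges_neq0 (S := spiral_region k)).
(* The root -1 lies on the boundary spiral. *)
- move=> x Sx; rewrite addrC addr_eq0; apply: contraTneq Sx => ->.
  by rewrite (spiral_regionNreal k (@ltr01 R)) ltxx.
- by move=> a b c d; apply: asano_contraction.
- by move=> x y; rewrite -{1}betaE -gammaE; apply: spiral_edge_neq0.
- by move=> e; rewrite mem_enum; exact: card_edge.
- by move=> v; have [zIm zRe] := zP v; exact: strip.
Qed.
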